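(* Let $U_8^{13}$ be the set of all $L(C)\in TLeib_8$ with $c_{3,4}=0$, $c_{2,3}\neq 0$, $c_{1,1}=c_{0,1}=0$, $c_{1,2}\neq 0$ and $2c_{2,4}c_{1,2}^2-3c_{1,3}c_{2,3}c_{1,2}+3c_{1,3}c_{2,3}^2\neq 0$. 1. Two algebras $L(C)$ and $L(C')$ from $U_8^{13}$ are isomorphic if and only if $$\frac{{c'}_{2,3}^{7}{c'}_{1,2}^{12}c'_{0,0}}{\left(-3c'_{1,3}c'_{2,3}c'_{1,2}+3c'_{1,3}{c'}_{2,3}^{2}+2{c'}_{1,2}^{2}c'_{2,4}\right)^6}=\frac{c_{2,3}^7c_{1,2}^{12}c_{0,0}}{\left(-3c_{1,3}c_{2,3}c_{1,2}+3c_{1,3}c_{2,3}^2+2c_{1,2}^2c_{2,4}\right)^6}\quad\text{and}\quad\frac{c'_{1,2}}{c'_{2,3}}=\frac{c_{1,2}}{c_{2,3}}.$$ 2. For any $\lambda_1\in\mathbb{C}$ and $\lambda_2\in\mathbb{C}^*=\mathbb{C}\setminus\{0\}$ there exists $L(C)\in U_8^{13}$ with $\frac{c_{2,3}^7c_{1,2}^{12}c_{0,0}}{(-3c_{1,3}c_{2,3}c_{1,2}+3c_{1,3}c_{2,3}^2+2c_{1,2}^2c_{2,4})^6}=\lambda_1$ and $\frac{c_{1,2}}{c_{2,3}}=\lambda_2$. Moreover, the orbits (isomorphism classes) in $U_8^{13}$ are parameterized by the algebras $L(\lambda_1,0,0,\lambda_2,0,0,0,1,1,0)$, $\lambda_1\in\mathbb{C}$,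 $\lambda_2\in\mathbb{C}^*$: these algebras lie in $U_8^{13}$ and every algebra in $U_8^{13}$ is isomorphic to one of them.
   Context: All algebras are over $\mathbb{C}$. For $C=(c_{0,0},c_{0,1},c_{1,1},c_{1,2},c_{1,3},c_{1,4},c_{1,5},c_{2,3},c_{2,4},c_{3,4})\in\mathbb{C}^{10}$, $L(C)$ denotes the $8$-dimensional complex algebra with basis $e_0,\dots,e_7$ and products (products of basis vectors not listed are zero): $[e_i,e_0]=e_{i+1}$ for $1\le i\le 6$; $[e_0,e_i]=-e_{i+1}$ for $2\le i\le 6$; $[e_0,e_0]=c_{0,0}e_7$; $[e_0,e_1]=-e_2+c_{0,1}e_7$; $[e_1,e_1]=c_{1,1}e_7$; $[e_1,e_2]=-[e_2,e_1]=c_{1,2}e_4+c_{1,3}e_5+c_{1,4}e_6+c_{1,5}e_7$; $[e_1,e_3]=-[e_3,e_1]=c_{1,2}e_5+c_{1,3}e_6+c_{1,4}e_7$; $[e_1,e_4]=-[e_4,e_1]=(c_{1,2}-c_{2,3})e_6+(c_{1,3}-c_{2,4})e_7$; $[e_1,e_5]=-[e_5,e_1]=(c_{1,2}-2c_{2,3})e_7$; $[e_2,e_3]=-[e_3,e_2]=c_{2,3}e_6+c_{2,4}e_7$; $[e_2,e_4]=-[e_4,e_2]=c_{2,3}e_7$; $[e_i,e_{7-i}]=-[e_{7-i},e_i]=(-1)^ic_{3,4}e_7$ for $1\le i\le 6$. $TLeib_8$ is the set of all $L(C)$ with $c_{3,4}(c_{2,3}+2c_{1,2})=0$ (the condition for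 $L(C)$ to be a Leibniz algebra, i.e. to satisfy $[x,[y,z]]=[[x,y],z]-[[x,z],y]$). The entries of $C'$ are denoted $c'_{i,j}$, in the same order. ''Isomorphic'' means isomorphic as algebras over $\mathbb{C}$; an orbit is an isomorphism class. *)

(* Defs.v *)
From mathcomp Require Import all_boot all_order all_algebra.
From mathcomp Require Import reals complex.

Set Implicit Arguments.
Unset Strict Implicit.
Unset Printing Implicit Defensive.

Import GRing.Theory.
Local Open Scope ring_scope.

Definition alg_isomorphic (F : fieldType) (V W : lmodType F)
    (mulV : V -> V -> V) (mulW : W -> W -> W) : Prop :=
  exists f : {linear V -> W},
    bijective f /\ forall x y : V, f (mulV x y) = mulW (f x) (f y).

Record params (F : Type) : Type := Params {
  c00 : F; c01 : F; c11 : F; c12 : F; c13 : F; c14 : F; c15 : F;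
  c23 : F; c24 : F; c34 : F }.

(* [inord] sends indices above 7 to 0: only [e k] with k <= 7 is meaningful. *)
Definition e (F : fieldType) (k : nat) : 'rV[F]_8 := delta_mx 0 (inord k).

(* [e_i, e_j] for 1 <= i < j <= 7. *)
Definition upper_prod (F : fieldType) (C : params F) (i j : nat) : 'rV[F]_8 :=
  match i, j with
  | 1, 2 => c12 C *: e F 4 + c13 C *: e F 5 + c14 C *: e F 6 + c15 C *: e F 7
  | 1, 3 => c12 C *: e F 5 + c13 C *: e F 6 + c14 C *: e F 7
  | 1, 4 => (c12 C - c23 C) *: e F 6 + (c13 C - c24 C) *: e F 7
  | 1, 5 => (c12 C - 2 * c23 C) *: e F 7
  | 2, 3 => c23 C *: e F 6 + c24 C *: e F 7
  | 2, 4 => c23 C *: e F 7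
  | _, _ => if (i + j == 7)%N then ((-1) ^+ i * c34 C) *: e F 7 else 0
  end.

Definition basis_prod (F : fieldType) (C : params F) (i j : nat) : 'rV[F]_8 :=
  match i, j with
  | 0, 0 => c00 C *: e F 7
  | 0, 1 => - e F 2 + c01 C *: e F 7
  | 0, _ => if (j <= 6)%N then - e F j.+1 else 0
  | _, 0 => if (i <= 6)%N then e F i.+1 else 0
  | 1, 1 => c11 C *: e F 7
  | _, _ => if (i < j)%N then upper_prod C i j
            else if (j < i)%N then - upper_prod C j i
            else 0
  end.

(* The product of the algebra L(C), whose underlying space is F^8. *)
Definition L (F : fieldType) (C : params F) (x y : 'rV[F]_8) : 'rV[F]_8 :=
  \sum_(i < 8) \sum_(j < 8) (x 0 i * y 0 j) *: basis_prod C i j.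

(* C |-> L(C) is injective, so sets of algebras L(C) are rendered as
   predicates on the parameter C. *)
Definition TLeib8 (F : fieldType) (C : params F) : Prop :=
  c34 C * (c23 C + 2 * c12 C) = 0.

Definition U8_13 (F : fieldType) (C : params F) : Prop :=
  TLeib8 C /\ c34 C = 0 /\ c23 C != 0 /\ (c11 C = 0 /\ c01 C = 0) /\
  c12 C != 0 /\
  2 * c24 C * c12 C ^+ 2 - 3 * c13 C * c23 C * c12 C
    + 3 * c13 C * c23 C ^+ 2 != 0.

Definition invariant1 (F : fieldType) (C : params F) : F :=
  c23 C ^+ 7 * c12 C ^+ 12 * c00 C /
  (- 3 * c13 C * c23 C * c12 C + 3 * c13 C * c23 C ^+ 2
     + 2 * c12 C ^+ 2 * c24 C) ^+ 6.

Definition invariant2 (F : fieldType) (C : params F) : F := c12 C / c23 C.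

(* Main.v *)
Require Import Defs.
From mathcomp Require Import all_boot all_order all_algebra.
From mathcomp Require Import reals complex.
From HB Require Import structures.
From mathcomp Require Import ring.

Import GRing.Theory Num.Theory.
Local Open Scope ring_scope.

(** When c01 = c11 = c34 = 0 the product of L(C) is an alternating product plus
    x_0 y_0 c00 e_7, with e_7 central, and L(C) is generated by e_0 and e_1.
    So an isomorphism is determined by the images of these two generators, and
    everything reduces to a normal form and its rigidity.

    Normal form ([normal_form]).  Three changes of generators suffice:
    - e_0 |-> e_0 + s e_1 adds 2 s c12^2 to c13, so as c12 <> 0 a suitable s
      kills c13; c24 then becomes J / (2 c12^2), where
      J = 2 c24 c12^2 - 3 c13 c23 c12 + 3 c13 c23^2 is the quantity assumed
      nonzero ([shear_iso]);
    - e_1 |-> e_1 + t e_3 + u e_4 subtracts 2 t c23 from c14 and 3 u c23 (plus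
      a multiple of t) from c15, so as c23 <> 0 both can be killed
      ([strip_iso]);
    - e_0 |-> a e_0, e_1 |-> b e_1 multiplies c12 and c23 by b / a^2, c24 by
      b / a^3 and c00 by 1 / (b a^4), so c23 and c24 can be made equal to 1
      ([scale_iso]).
    Then c12 has become c12 / c23, the second invariant, and c00 has become
    64 times the first one, the 64 being the 2^6 in (J / (2 c12^2))^6.

    Rigidity ([canonical_rigid]).  Two distinct canonical algebras are not
    isomorphic.  Let f be an isomorphism, a and s the coordinates of f(e_0)
    along e_0 and e_1, and b that of f(e_1) along e_1.  The f(e_i) with i >= 2
    are iterated products with f(e_0), hence triangular; comparing the lowest
    coordinates in [e_1, e_2] = l2 e_4 and [e_2, e_3] = e_6 + e_7 gives
    b = a^2 and the equality of the values of l2.  The next coordinates of the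
    same two relations give s = 0 and then a = 1, after which
    [e_0, e_0] = l1 e_7 gives the equality of the values of l1.

    Two algebras with equal invariants thus share their normal form, and two
    isomorphic ones have isomorphic, hence equal, normal forms. *)

(** * Isomorphism of algebras *)

Lemma alg_isomorphic_sym {F : fieldType} {V W : lmodType F}
    {mulV : V -> V -> V} {mulW : W -> W -> W} :
  alg_isomorphic mulV mulW -> alg_isomorphic mulW mulV.
Proof.
move=> [f [[g fK gK] fM]].
have g_lin : linear g by exact: can2_linear fK gK.
pose gL : {linear W -> V} := HB.pack g (GRing.isLinear.Build _ _ _ _ g g_lin).
exists gL; split; first by exists f.
by move=> x y; apply: (can_inj fK); rewrite fM !gK.
Qed.

Lemma alg_isomorphic_trans {F : fieldType} {U V W : lmodType F}
    {mulU : U -> U -> U} {mulV : V -> V -> V} {mulW : W -> W -> W} :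
  alg_isomorphic mulU mulV -> alg_isomorphic mulV mulW ->
  alg_isomorphic mulU mulW.
Proof.
move=> [f [f_bij fM]] [g [g_bij gM]]; exists (g \o f)%FUN.
by split=> [|x y]; [exact: bij_comp | rewrite /= fM gM].
Qed.

(** * Products in coordinates *)

(** Coordinates indexed by natural numbers rather than by ['I_8], so that
    concrete indices compute. *)
Definition entry {F : fieldType} (x : 'rV[F]_8) (k : nat) : F :=
  x 0 (@inord 7 k).

Lemma row8P {F : fieldType} (x y : 'rV[F]_8) :
  (forall k, (k < 8)%N -> entry x k = entry y k) -> x = y.
Proof.
by move=> eq_xy; apply/rowP=> i; rewrite -(inord_val i); apply: eq_xy.
Qed.

Lemma sum8 {V : zmodType} (G : nat -> V) :
  \sum_(i < 8) G i =
  G 0%N + (G 1%N + (G 2 + (G 3 + (G 4 + (G 5 + (G 6 + G 7)))))).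
Proof. by rewrite !big_ord_recl big_ord0 addr0. Qed.

Lemma entry_e {F : fieldType} (i k : nat) : (i < 8)%N -> (k < 8)%N ->
  entry (e F i) k = (k == i)%:R.
Proof.
by move=> lt_i lt_k; rewrite /entry mxE eqxx -val_eqE /= !inordK.
Qed.

Definition lie_params {F : fieldType} (k00 k12 k13 k14 k15 k23 k24 : F) :=
  Params k00 0 0 k12 k13 k14 k15 k23 k24 0.

Definition wedge {F : fieldType} (x y : nat -> F) (i j : nat) : F :=
  x i * y j - x j * y i.

(** The vanishing of c01 and c11 makes the product of L(C) alternating up to
    the term c00 x_0 y_0 e_7, and that of c34 leaves every product of two basis
    vectors of positive index to c12, c13, c14, c15, c23 and c24. *)
Definition lie_type {F : fieldType} (C : params F) : Prop :=
  [/\ c01 C = 0, c11 C = 0 & c34 C = 0].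

Definition lie_mul {F : fieldType} (C : params F) (x y : nat -> F) : nat -> F :=
  nth 0
  [:: 0; 0; wedge x y 1 0; wedge x y 2 0;
      wedge x y 3 0 + c12 C * wedge x y 1 2;
      wedge x y 4 0 + c13 C * wedge x y 1 2 + c12 C * wedge x y 1 3;
      wedge x y 5 0 + c14 C * wedge x y 1 2 + c13 C * wedge x y 1 3
        + (c12 C - c23 C) * wedge x y 1 4 + c23 C * wedge x y 2 3;
      wedge x y 6 0 + c15 C * wedge x y 1 2 + c14 C * wedge x y 1 3
        + (c13 C - c24 C) * wedge x y 1 4
        + (c12 C - 2 * c23 C) * wedge x y 1 5
        + c24 C * wedge x y 2 3 + c23 C * wedge x y 2 4
        + c00 C * (x 0%N * y 0%N)].

Lemma entryD {F : fieldType} (x y : 'rV[F]_8) k :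
  entry (x + y) k = entry x k + entry y k.
Proof. exact: mxE. Qed.

Lemma entryN {F : fieldType} (x : 'rV[F]_8) k : entry (- x) k = - entry x k.
Proof. exact: mxE. Qed.

Lemma entryZ {F : fieldType} a (x : 'rV[F]_8) k :
  entry (a *: x) k = a * entry x k.
Proof. exact: mxE. Qed.

Lemma L_nat {F : fieldType} (C : params F) x y :
  L C x y =
  \sum_(i < 8) \sum_(j < 8) (entry x i * entry y j) *: basis_prod C i j.
Proof.
by apply: eq_bigr => i _; apply: eq_bigr => j _; rewrite /entry !inord_val.
Qed.

Lemma entry_L {F : fieldType} (C : params F) x y k :
  lie_type C -> (k < 8)%N ->
  entry (L C x y) k = lie_mul C (entry x) (entry y) k.
Proof.
move=> [C01 C11 C34] lt_k; rewrite L_nat.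
pose G i j := (entry x i * entry y j) *: basis_prod C i j.
rewrite (sum8 (fun i => \sum_(j < 8) G i j)) !(sum8 (G _)) {}/G.
rewrite /= C01 C11 C34 mulr0 !(scale0r, scaler0, oppr0, addr0, add0r).
move: (entry x) (entry y) => {}x {}y.
rewrite !(entryD, entryN, entryZ, entry_e) //= /lie_mul.
do 8?[case: k lt_k => [|k] lt_k] => //; rewrite /= /wedge.
all: ring.
Qed.

(** * Changes of basis *)

Definition mx8 {F : fieldType} (rows : seq (seq F)) : 'M[F]_8 :=
  \matrix_(i, j) (nth [::] rows i)`_j.

(** The product of a row vector by [mx8 rows], spelt out on coordinate
    functions so that it reduces by computation on explicit rows. *)
Definition act_rows {F : fieldType} (rows : seq (seq F))
    (x : nat -> F) (k : nat) : F :=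
  let G i := x i * (nth [::] rows i)`_k in
  G 0%N + (G 1%N + (G 2 + (G 3 + (G 4 + (G 5 + (G 6 + G 7)))))).

Lemma entry_mx8 {F : fieldType} (x : 'rV[F]_8) rows k : (k < 8)%N ->
  entry (x *m mx8 rows) k = act_rows rows (entry x) k.
Proof.
move=> lt_k; rewrite /act_rows /= -(sum8 (fun i => _ i * _)) /entry mxE.
by apply: eq_bigr => i _; rewrite mxE inord_val inordK.
Qed.

Lemma mx8_unit {F : fieldType} (rows : seq (seq F)) :
  (forall i j, (i < 8)%N -> (j < i)%N -> (nth [::] rows i)`_j = 0) ->
  (forall i, (i < 8)%N -> (nth [::] rows i)`_i != 0) ->
  mx8 rows \in unitmx.
Proof.
move=> below diag; rewrite unitmxE -det_tr det_trig.
  by rewrite unitfE; apply/prodf_neq0 => i _; rewrite !mxE diag.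
by apply/is_trig_mxP => i j lt_ij; rewrite !mxE below.
Qed.

(** The i-th row holds the coordinates of the image of e_i.  Multiplicativity
    is asked for generic coordinate functions: for explicit rows it becomes
    eight polynomial identities. *)
Lemma alg_isomorphic_rows {F : fieldType} (C C' : params F) rows :
  lie_type C -> lie_type C' ->
  (forall i j, (i < 8)%N -> (j < i)%N -> (nth [::] rows i)`_j = 0) ->
  (forall i, (i < 8)%N -> (nth [::] rows i)`_i != 0) ->
  (forall x y k, (k < 8)%N ->
     act_rows rows (lie_mul C x y) k =
     lie_mul C' (act_rows rows x) (act_rows rows y) k) ->
  alg_isomorphic (L C) (L C').
Proof.
move=> lieC lieC' below diag act_rowsM.
have M_unit : mx8 rows \in unitmx by exact: mx8_unit.
exists (mulmxr (mx8 rows) : {linear 'rV[F]_8 -> 'rV[F]_8}); split.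
  exists (mulmxr (invmx (mx8 rows))) => x /=; first exact: mulmxK.
  exact: mulmxKV.
move=> x y; apply: row8P => k lt_k /=.
rewrite entry_mx8 // entry_L //.
transitivity (act_rows rows (lie_mul C (entry x) (entry y)) k).
  by rewrite /act_rows !entry_L.
rewrite act_rowsM //; do 8?[case: k lt_k => [|k] lt_k] => //.
all: by rewrite /lie_mul /= /wedge !entry_mx8.
Qed.

(** The change of generators e_0 |-> e_0 + s e_1.  The rows are obtained by
    multiplying repeatedly by the new e_0 on the right.  The new values of c14
    and c15 are left existential because [strip_iso] can give them any value
    whenever 6 c23 is invertible. *)
Lemma shear_iso {F : fieldType} (s k00 k12 k13 k14 k15 k23 k24 : F) :
  exists k14' k15',
  alg_isomorphic
    (L (lie_params k00 k12 (k13 + 2 * s * k12 ^+ 2) k14' k15' k23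
          (k24 + 3 * s * k23 * (k12 - k23))))
    (L (lie_params k00 k12 k13 k14 k15 k23 k24)).
Proof.
pose k14' := k14 + s * (5 * k12 * k13 - k13 * k23)
  + s ^+ 2 * k12 ^+ 2 * (5 * k12 - k23).
pose k15' := k15
  + s * (6 * k12 * k14 + 3 * k13 ^+ 2 - k13 * k24 - 3 * k14 * k23)
  + s ^+ 2 * (21 * k12 ^+ 2 * k13 - k12 ^+ 2 * k24 - 12 * k12 * k13 * k23
              + 3 * k13 * k23 ^+ 2)
  + s ^+ 3 * k12 ^+ 2 * (14 * k12 ^+ 2 - 9 * k12 * k23 + 3 * k23 ^+ 2).
exists k14', k15'.
pose rows :=
  [:: [:: 1; s; 0; 0; 0; 0; 0; 0];
      [:: 0; 1; 0; 0; 0; 0; 0; 0];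
      [:: 0; 0; 1; 0; 0; 0; 0; 0];
      [:: 0; 0; 0; 1; - s * k12; - s * k13; - s * k14; - s * k15];
      [:: 0; 0; 0; 0; 1; - 2 * s * k12;
          s ^+ 2 * k12 * (k12 - k23) - 2 * s * k13;
          s ^+ 2 * (2 * k12 * k13 - k12 * k24 - 2 * k13 * k23)
            - 2 * s * k14];
      [:: 0; 0; 0; 0; 0; 1; s * (k23 - 3 * k12);
          s ^+ 2 * k12 * (3 * k12 - 5 * k23) + s * (k24 - 3 * k13)];
      [:: 0; 0; 0; 0; 0; 0; 1; s * (3 * k23 - 4 * k12)];
      [:: 0; 0; 0; 0; 0; 0; 0; 1]].
apply: (@alg_isomorphic_rows _ _ _ rows) => //.
- by case=> [|[|[|[|[|[|[|[|i]]]]]]]] [|[|[|[|[|[|[|[|j]]]]]]]] //=.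
- by case=> [|[|[|[|[|[|[|[|i]]]]]]]] //= _; rewrite oner_neq0.
move=> x y [|[|[|[|[|[|[|[|k]]]]]]]] //= _.
all: rewrite /act_rows /lie_mul /wedge /=.
all: rewrite /k14' /k15'.
all: ring.
Qed.

(** The change of generators e_1 |-> e_1 + t e_3 + u e_4.  Right multiplication
    by e_0 shifts indices, so every later row is a shift of the second one. *)
Lemma strip_iso {F : fieldType} (t u k00 k12 k13 k14 k15 k23 k24 : F) :
  alg_isomorphic
    (L (lie_params k00 k12 k13 (k14 - 2 * t * k23)
          (k15 - 3 * u * k23 - 2 * t * k24) k23 k24))
    (L (lie_params k00 k12 k13 k14 k15 k23 k24)).
Proof.
pose rows :=
  [:: [:: 1; 0; 0; 0; 0; 0; 0; 0];
      [:: 0; 1; 0; t; u; 0; 0; 0];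
      [:: 0; 0; 1; 0; t; u; 0; 0];
      [:: 0; 0; 0; 1; 0; t; u; 0];
      [:: 0; 0; 0; 0; 1; 0; t; u];
      [:: 0; 0; 0; 0; 0; 1; 0; t];
      [:: 0; 0; 0; 0; 0; 0; 1; 0];
      [:: 0; 0; 0; 0; 0; 0; 0; 1]].
apply: (@alg_isomorphic_rows _ _ _ rows) => //.
- by case=> [|[|[|[|[|[|[|[|i]]]]]]]] [|[|[|[|[|[|[|[|j]]]]]]]] //=.
- by case=> [|[|[|[|[|[|[|[|i]]]]]]]] //= _; rewrite oner_neq0.
move=> x y [|[|[|[|[|[|[|[|k]]]]]]]] //= _.
all: rewrite /act_rows /lie_mul /wedge /=.
all: ring.
Qed.

(** The change of generators e_0 |-> a e_0, e_1 |-> b e_1, under which e_i is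
    multiplied by b a^(i-1) for i >= 1. *)
Lemma scale_iso {F : fieldType} (a b k00 k12 k13 k14 k15 k23 k24 : F) :
  a != 0 -> b != 0 ->
  alg_isomorphic
    (L (lie_params (k00 / (b * a ^+ 4)) (k12 * b / a ^+ 2) (k13 * b / a ^+ 3)
          (k14 * b / a ^+ 4) (k15 * b / a ^+ 5)
          (k23 * b / a ^+ 2) (k24 * b / a ^+ 3)))
    (L (lie_params k00 k12 k13 k14 k15 k23 k24)).
Proof.
move=> a0 b0.
pose rows := [seq rcons (nseq i 0) (if i is j.+1 then b * a ^+ j else a)
             | i <- iota 0 8].
apply: (@alg_isomorphic_rows _ _ _ rows) => //.
- by case=> [|[|[|[|[|[|[|[|i]]]]]]]] [|[|[|[|[|[|[|[|j]]]]]]]] //=.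
- by case=> [|[|[|[|[|[|[|[|i]]]]]]]] //= _; rewrite ?mulf_neq0 ?expf_neq0.
move=> x y [|[|[|[|[|[|[|[|k]]]]]]]] //= _.
all: rewrite /act_rows /lie_mul /wedge /=.
all: by field; rewrite ?a0 ?b0.
Qed.

(** * Normal form *)

Definition canonical {F : fieldType} (l1 l2 : F) : params F :=
  lie_params l1 l2 0 0 0 1 1.

Lemma normal_form {F : numFieldType} {C : params F} : U8_13 C ->
  alg_isomorphic (L C) (L (canonical (64 * invariant1 C) (invariant2 C))).
Proof.
case: C => k00 k01 k11 k12 k13 k14 k15 k23 k24 k34.
case=> _ [/= -> [k23_0 [[-> ->] [k12_0 J0]]]].
set J := 2 * k24 * k12 ^+ 2 - 3 * k13 * k23 * k12 + 3 * k13 * k23 ^+ 2 in J0.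
have n2 : 2 != 0 :> F by rewrite pnatr_eq0.
have n3 : 3 != 0 :> F by rewrite pnatr_eq0.
apply: alg_isomorphic_sym.
pose s := - k13 / (2 * k12 ^+ 2).
have [k14' [k15' shear]] := shear_iso s k00 k12 k13 k14 k15 k23 k24.
apply: (alg_isomorphic_trans _ shear).
(* d is the value of c24 once c13 has been killed. *)
pose d := J / (2 * k12 ^+ 2).
have -> : k24 + 3 * s * k23 * (k12 - k23) = d.
  by rewrite /s /d /J; field; rewrite ?n2 ?k12_0.
have -> : k13 + 2 * s * k12 ^+ 2 = 0.
  by rewrite /s; field; rewrite ?n2 ?k12_0.
have d0 : d != 0 by rewrite !(mulf_neq0, invr_neq0, expf_neq0).
pose t := k14' / (2 * k23).
pose u := (k15' - 2 * t * d) / (3 * k23).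
apply: (alg_isomorphic_trans _ (strip_iso t u _ _ _ _ _ _ _)).
have -> : k14' - 2 * t * k23 = 0 by rewrite /t; field; rewrite ?n2.
have -> : k15' - 3 * u * k23 - 2 * t * d = 0.
  by rewrite /u; field; rewrite ?n3.
(* The scaling factors solving k23 * b / a^2 = 1 and d * b / a^3 = 1. *)
pose a := d / k23; pose b := a ^+ 2 / k23.
have a0 : a != 0 by rewrite mulf_neq0 ?invr_neq0.
have b0 : b != 0 by rewrite mulf_neq0 ?invr_neq0 ?expf_neq0.
have := scale_iso a b k00 k12 0 0 0 k23 d a0 b0.
rewrite !mul0r /canonical /lie_params /invariant1 /invariant2 /=.
have -> : k23 * b / a ^+ 2 = 1.
  by rewrite /b; field; rewrite ?a0 ?k23_0.
have -> : d * b / a ^+ 3 = 1.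
  by rewrite /b /a; field; rewrite ?d0 ?k23_0.
have -> : k12 * b / a ^+ 2 = k12 / k23.
  by rewrite /b; field; rewrite ?a0 ?k23_0.
have -> // : k00 / (b * a ^+ 4) =
  64 * (k23 ^+ 7 * k12 ^+ 12 * k00 / (- 3 * k13 * k23 * k12
          + 3 * k13 * k23 ^+ 2 + 2 * k12 ^+ 2 * k24) ^+ 6).
have -> : - 3 * k13 * k23 * k12 + 3 * k13 * k23 ^+ 2 + 2 * k12 ^+ 2 * k24 = J.
  by rewrite /J; ring.
by rewrite /b /a /d; field; rewrite ?J0 ?k23_0 ?k12_0.
Qed.

(** * Rigidity of the canonical algebras *)

Lemma L_e {F : fieldType} (C : params F) (i j : nat) :
  (i < 8)%N -> (j < 8)%N -> L C (e F i) (e F j) = basis_prod C i j.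
Proof.
move=> lt_i lt_j; rewrite L_nat (bigD1 (Ordinal lt_i)) //=.
rewrite (bigD1 (Ordinal lt_j)) //= !entry_e // !eqxx mulr1 scale1r.
rewrite !big1 ?addr0 // => [i' ne_i'|j' ne_j'].
  apply: big1 => j' _; rewrite !entry_e //.
  by rewrite (negPf ne_i' : (i' == i :> nat) = false) mul0r scale0r.
by rewrite !entry_e // (negPf ne_j' : (j' == j :> nat) = false) mulr0 scale0r.
Qed.

(** Reduces an equation that follows linearly from another one to a ring
    identity. *)
Lemma eq_from_sub {V : zmodType} {u v x y : V} :
  u = v -> x - y = u - v -> x = y.
Proof. by move=> ->; rewrite subrr => /subr0_eq. Qed.

(** Below, [X i] is the coordinate function of f(e_i); each relation between
    basis vectors of the source is a polynomial relation between the [X i]. *)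
Lemma canonical_rigid {F : numFieldType} (l1 l2 m1 m2 : F) :
  m2 != 0 ->
  alg_isomorphic (L (canonical l1 l2)) (L (canonical m1 m2)) ->
  l1 = m1 /\ l2 = m2.
Proof.
move=> m2_0 [f [f_bij fM]]; have f_inj := bij_inj f_bij.
have n2 : 2 != 0 :> F by rewrite pnatr_eq0.
pose X i : nat -> F := entry (f (e F i)).
have prodX i j k : (i < 8)%N -> (j < 8)%N -> (k < 8)%N ->
    lie_mul (canonical m1 m2) (X i) (X j) k
    = entry (f (basis_prod (canonical l1 l2) i j)) k.
  by move=> lt_i lt_j lt_k; rewrite -L_e // fM entry_L.
have stepX i k : (0 < i < 7)%N -> (k < 8)%N ->
    X i.+1 k = lie_mul (canonical m1 m2) (X i) (X 0%N) k.
  case: i => // i lt_i lt_k; rewrite prodX //; last by apply: ltnW.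
  by move: lt_i; do 6?[case: i => [|i]].
(* D is the determinant of f on the quotient by the span of e_2, ..., e_7;
   modulo higher basis vectors, f(e_i) is D a^(i-2) e_i for i >= 2, where a
   is the coordinate X 0 0. *)
pose D := X 1%N 1%N * X 0%N 0%N - X 1%N 0%N * X 0%N 1%N.
have X2 : [/\ X 2 0%N = 0, X 2 1%N = 0 & X 2 2 = D].
  by rewrite !(stepX 1%N) // /lie_mul /= /wedge.
have X3 : [/\ X 3 0%N = 0, X 3 1%N = 0, X 3 2 = 0 & X 3 3 = D * X 0%N 0%N].
  rewrite !(stepX 2) // /lie_mul /= /wedge; case: X2 => -> -> ->.
  by split; ring.
have X4 : [/\ X 4 0%N = 0, X 4 1%N = 0, X 4 2 = 0, X 4 3 = 0
            & X 4 4 = D * X 0%N 0%N ^+ 2].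
  rewrite !(stepX 3) // /lie_mul /= /wedge; case: X3 => -> -> -> ->.
  by split; ring.
have X5 : [/\ X 5 0%N = 0, X 5 1%N = 0, X 5 2 = 0 & X 5 3 = 0] /\
          X 5 4 = 0 /\ X 5 5 = D * X 0%N 0%N ^+ 3.
  rewrite !(stepX 4) // /lie_mul /= /wedge; case: X4 => -> -> -> -> ->.
  by do !split; ring.
have X6 : [/\ X 6 0%N = 0, X 6 1%N = 0, X 6 2 = 0 & X 6 3 = 0] /\
          [/\ X 6 4 = 0, X 6 5 = 0 & X 6 6 = D * X 0%N 0%N ^+ 4].
  rewrite !(stepX 5) // /lie_mul /= /wedge; case: X5 => [[-> -> -> ->] [-> ->]].
  by do !split; ring.
have X7 : [/\ X 7 0%N = 0, X 7 1%N = 0, X 7 2 = 0 & X 7 3 = 0] /\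
          [/\ X 7 4 = 0, X 7 5 = 0, X 7 6 = 0 & X 7 7 = D * X 0%N 0%N ^+ 5].
  rewrite !(stepX 6) // /lie_mul /= /wedge.
  case: X6 => [[-> -> -> ->] [-> -> ->]].
  by do !split; ring.
have X77_0 : X 7 7 != 0.
  apply: contra_neqN (oner_neq0 F) => /eqP X77.
  have: f (e F 7) = 0.
    apply: row8P => k lt_k; rewrite -/(X 7 k) [RHS]mxE.
    case: X7 => [[z0 z1 z2 z3] [z4 z5 z6 _]].
    by do 8?[case: k lt_k => [|k] lt_k].
  rewrite -(raddf0 f) => /f_inj /(congr1 (fun v => entry v 7)).
  by rewrite entry_e // /entry mxE.
have prod12 k : (k < 8)%N ->
    lie_mul (canonical m1 m2) (X 1%N) (X 2) k = l2 * X 4 k.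
  by move=> lt_k; rewrite prodX //= !scale0r !addr0 linearZ /= entryZ.
have prod23 k : (k < 8)%N ->
    lie_mul (canonical m1 m2) (X 2) (X 3) k = X 6 k + X 7 k.
  by move=> lt_k; rewrite prodX //= !scale1r linearD entryD.
(* The coordinates of f(e_2), ..., f(e_6) just above the diagonal. *)
have X23 : X 2 3 = X 1%N 2 * X 0%N 0%N - X 1%N 0%N * X 0%N 2.
  by rewrite (stepX 1%N).
have X34 : X 3 4 = X 2 3 * X 0%N 0%N - m2 * D * X 0%N 1%N.
  by rewrite (stepX 2) // /lie_mul /= /wedge; case: X2 => -> -> ->; ring.
have X45 : X 4 5 = X 3 4 * X 0%N 0%N - m2 * X 3 3 * X 0%N 1%N.
  by rewrite (stepX 3) // /lie_mul /= /wedge; case: X3 => -> -> -> _; ring.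
have X56 : X 5 6 = X 4 5 * X 0%N 0%N - (m2 - 1) * X 4 4 * X 0%N 1%N.
  by rewrite (stepX 4) // /lie_mul /= /wedge; case: X4 => -> -> -> -> _; ring.
have X67 : X 6 7 = X 5 6 * X 0%N 0%N - (m2 - 2) * X 5 5 * X 0%N 1%N.
  rewrite (stepX 5) // /lie_mul /= /wedge.
  by case: X5 => [[-> -> -> ->] [-> _]]; ring.
have P3 := prod12 3 isT; have P4 := prod12 4 isT; have P5 := prod12 5 isT.
have Q6 := prod23 6 isT; have Q7 := prod23 7 isT.
have S7 : m1 * X 0%N 0%N ^+ 2 = l1 * X 7 7.
  have := prodX 0%N 0%N 7 isT isT isT.
  rewrite /= linearZ /= entryZ -/(X 7 7) => <-.
  by rewrite /lie_mul /= /wedge; ring.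
move: P3 P4 P5 Q6 Q7 S7 X77_0; rewrite /lie_mul /= /wedge.
rewrite X67 X56 X45 X34.
case: X7 => _ [_ _ -> ->]; case: X6 => _ [_ _ ->]; case: X5 => _ [_ ->].
case: X4 => [_ _ _ -> ->]; case: X3 => [-> -> -> ->]; case: X2 => [-> -> ->].
rewrite X23 {stepX prodX X23 X34 X45 X56 X67}.
set a := X 0%N 0%N; set s := X 0%N 1%N; set b := X 1%N 1%N.
move=> P3 P4 P5 Q6 Q7 S7; rewrite mulf_eq0 negb_or => /andP [D0 a5_0].
have a0 : a != 0 by apply: contraNneq a5_0 => ->; rewrite expr0n.
(* P3, P4, P5 are the coordinates 3, 4, 5 of [e_1, e_2] = l2 e_4; Q6, Q7 are
   the coordinates 6, 7 of [e_2, e_3] = e_6 + e_7; S7 is the coordinate 7 of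
   [e_0, e_0] = l1 e_7. *)
have B0 : X 1%N 0%N = 0.
  by apply: (mulIf D0); apply: (eq_from_sub (esym P3)); ring.
have defD : D = b * a by rewrite /D B0 mul0r subr0.
rewrite B0 in P4 P5 Q6 Q7.
have Da : D = a ^+ 3.
  by apply: (mulIf (mulf_neq0 D0 a0)); apply: (eq_from_sub Q6); ring.
have ba : b = a ^+ 2 by apply: (mulIf a0); rewrite -defD Da; ring.
have l2E : l2 = m2.
  apply: (mulIf (mulf_neq0 D0 (expf_neq0 2 a0))).
  by apply: (eq_from_sub (esym P4)); rewrite ba; ring.
have s0 : s = 0.
  have nz : 2 * m2 ^+ 2 * D * a != 0 by rewrite !mulf_neq0 ?expf_neq0.
  apply: (mulfI nz); apply: (eq_from_sub P5).
  by rewrite l2E ba; ring.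
have a1 : a = 1.
  apply: (mulfI (expf_neq0 7 a0)).
  by apply: (eq_from_sub (esym Q7)); rewrite s0 Da; ring.
by split=> //; move: S7; rewrite Da a1 !expr1n !mulr1.
Qed.

Lemma canonical_U8_13 {F : numFieldType} (l1 l2 : F) :
  l2 != 0 -> U8_13 (canonical l1 l2).
Proof.
move=> l2_0; rewrite /U8_13 /TLeib8 /= mul0r oner_neq0 l2_0.
do !split=> //.
by rewrite !(mulr0, mul0r, subr0, addr0) mulr1 mulf_neq0 ?expf_neq0 ?pnatr_eq0.
Qed.

Lemma invariants_canonical {F : numFieldType} (l1 l2 : F) : l2 != 0 ->
  invariant1 (canonical (64 * l1) l2) = l1 /\
  invariant2 (canonical (64 * l1) l2) = l2.
Proof.
move=> l2_0; rewrite /invariant1 /invariant2 /=.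
by split; field; rewrite ?l2_0 ?pnatr_eq0.
Qed.

Lemma invariant2_neq0 {F : fieldType} (C : params F) :
  U8_13 C -> invariant2 C != 0.
Proof. by case=> _ [_ [C23 [_ [C12 _]]]]; rewrite mulf_neq0 ?invr_neq0. Qed.

(** * Classification *)

Lemma isomorphic_iff_invariants {F : numFieldType} (C C' : params F) :
  U8_13 C -> U8_13 C' ->
  (alg_isomorphic (L C) (L C') <->
   invariant1 C' = invariant1 C /\ invariant2 C' = invariant2 C).
Proof.
move=> UC UC'; have isoC := normal_form UC; have isoC' := normal_form UC'.
split=> [isoCC'|[eq1 eq2]]; last first.
  apply: (alg_isomorphic_trans isoC).
  by rewrite -eq1 -eq2; exact: alg_isomorphic_sym.
have := alg_isomorphic_trans (alg_isomorphic_sym isoC)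
          (alg_isomorphic_trans isoCC' isoC').
case/canonical_rigid; first exact: invariant2_neq0.
have n64 : 64 != 0 :> F by rewrite pnatr_eq0.
by move=> /(mulfI n64) -> ->.
Qed.

Theorem proposition2p20 (R : realType) :
  (forall C C' : params R[i], U8_13 C -> U8_13 C' ->
     (alg_isomorphic (L C) (L C') <->
      invariant1 C' = invariant1 C /\ invariant2 C' = invariant2 C)) /\
  (forall lambda1 lambda2 : R[i], lambda2 != 0 ->
     exists C : params R[i],
       U8_13 C /\ invariant1 C = lambda1 /\ invariant2 C = lambda2) /\
  ((forall lambda1 lambda2 : R[i], lambda2 != 0 ->
      U8_13 (Params lambda1 0 0 lambda2 0 0 0 1 1 0)) /\
   (forall C : params R[i], U8_13 C ->
      exists lambda1 lambda2 : R[i], lambda2 != 0 /\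
        alg_isomorphic (L C) (L (Params lambda1 0 0 lambda2 0 0 0 1 1 0)))).
Proof.
split; first exact: isomorphic_iff_invariants.
split.
  move=> l1 l2 l2_0; exists (canonical (64 * l1) l2).
  by split; [exact: canonical_U8_13 | exact: invariants_canonical].
split=> [l1 l2 l2_0|C UC]; first exact: canonical_U8_13.
exists (64 * invariant1 C), (invariant2 C).
by split; [exact: invariant2_neq0 | exact: normal_form].
Qed.
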